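(* Let $n\geq 1$ and $k\geq 2$ be integers, and let $w$ be a length-$n$ word over $\Sigma_k$. Then $\operatorname{rankU}_k(w)$ can be computed (from $w$ and $k$) in $O(kn^3)$ time using $O(n)$ space, under the unit-cost RAM model.
   Context: $\Sigma_k=\{1,2,\ldots,k\}$ with $1<2<\cdots<k$. Lexicographic order: for $x=x_1\cdots x_m$ and $y=y_1\cdots y_n$, $x<y$ if $x$ is a proper prefix of $y$, or if $x_i<y_i$ for the smallest $i$ with $x_i\neq y_i$. A border of a word $w$ is a word that is both a non-empty proper prefix and a non-empty proper suffix of $w$; $w$ is bordered if it has a border and unbordered otherwise. $\operatorname{rankU}_k(w)$ denotes the rank (position, starting from $1$) of $w$ in the lexicographic listing of all unbordered words of length $|w|$ over $\Sigma_k$; for an arbitrary word $w$ of length $n$ this is taken to mean $1$ plus the number of length-$n$ unbordered words over $\Sigma_k$ that are lexicographically smaller than $w$. Unit-cost RAM model: integer variables use constant space and integer arithmetic operations take constant time. *)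

(* Defs.v *)
From mathcomp Require Import all_boot.
Set Implicit Arguments. Unset Strict Implicit. Unset Printing Implicit Defensive.

Fixpoint words (k n : nat) : seq (seq nat) :=
  match n with
  | 0 => [:: [::]]
  | n'.+1 => [seq a :: u | a <- iota 1 k, u <- words k n']
  end.

Fixpoint lexlt (x y : seq nat) : bool :=
  match x, y with
  | [::], [::] => false
  | [::], _ :: _ => true
  | _ :: _, [::] => false
  | a :: x', b :: y' => (a < b) || ((a == b) && lexlt x' y')
  end.

Definition bordered (w : seq nat) : bool :=
  has (fun i => take i w == drop (size w - i) w) (iota 1 (size w).-1).

Definition unbordered (w : seq nat) : bool := ~~ bordered w.

Definition rankU (k : nat) (w : seq nat) : nat :=
  1 + count (fun u => unbordered u && lexlt u w) (words k (size w)).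

(* Registers R[0], R[1], ... hold natural numbers (unbounded);
   each instruction costs one time unit. *)
Inductive instr :=
| IConst (d c : nat)
| IAdd (d a b : nat)
| ISub (d a b : nat)          (* R[d] := R[a] - R[b] (truncated) *)
| IMul (d a b : nat)
| IDiv (d a b : nat)          (* R[d] := R[a] / R[b] (0 if R[b] = 0) *)
| IMod (d a b : nat)
| ILoad (d a : nat)
| IStore (a s : nat)
| IJz (r t : nat)
| IJmp (t : nat)
| IHalt.

Definition upd (m : nat -> nat) (d v : nat) : nat -> nat :=
  fun i => if i == d then v else m i.

(* One step: returns the new pc, new memory, and the largest register
   address accessed during the step. [None] means halt. *)
Definition step (p : seq instr) (pc : nat) (m : nat -> nat)
  : option (nat * (nat -> nat) * nat) :=
  match nth IHalt p pc with
  | IConst d c => Some (pc.+1, upd m d c, d)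
  | IAdd d a b => Some (pc.+1, upd m d (m a + m b), maxn d (maxn a b))
  | ISub d a b => Some (pc.+1, upd m d (m a - m b), maxn d (maxn a b))
  | IMul d a b => Some (pc.+1, upd m d (m a * m b), maxn d (maxn a b))
  | IDiv d a b => Some (pc.+1, upd m d (m a %/ m b), maxn d (maxn a b))
  | IMod d a b => Some (pc.+1, upd m d (m a %% m b), maxn d (maxn a b))
  | ILoad d a => Some (pc.+1, upd m d (m (m a)), maxn d (maxn a (m a)))
  | IStore a s => Some (pc.+1, upd m (m a) (m s), maxn s (maxn a (m a)))
  | IJz r t => Some (if m r == 0 then t else pc.+1, m, r)
  | IJmp t => Some (t, m, 0)
  | IHalt => None
  end.

(* [run fuel p pc m] = Some (time, space, final memory) if the program halts
   within [fuel] steps (the halting instruction counts as a step);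
   space = 1 + the largest register address ever accessed. *)
Fixpoint run (fuel : nat) (p : seq instr) (pc : nat) (m : nat -> nat)
  : option (nat * nat * (nat -> nat)) :=
  match fuel with
  | 0 => None
  | f.+1 =>
    match step p pc m with
    | None => Some (1, 0, m)
    | Some (pc', m', a) =>
      match run f p pc' m' with
      | None => None
      | Some (t, s, mf) => Some (t.+1, maxn a.+1 s, mf)
      end
    end
  end.

(* Input convention: R[0] = k, R[1] = n = |w|, R[2+i] = w_{i+1}, all other
   registers 0.  Output convention: R[0] at halting time. *)
Definition ram_input (k : nat) (w : seq nat) : nat -> nat :=
  fun i => if i == 0 then k else if i == 1 then size w else nth 0 w (i - 2).

(* Main.v *)
Require Import Defs.
From mathcomp Require Import all_boot zify.
Set Implicit Arguments. Unset Strict Implicit. Unset Printing Implicit Defensive.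

(** The words smaller than [w] are classified by the first position [i] where they
    differ from [w] and the letter [a < w_i] found there, so the rank is a sum over
    at most [k n] prefixes [p = w_1 ... w_(i-1) a] of the number of unbordered words
    of length [n] that start with [p].  A bordered word has a unique unbordered
    border, of length [j] at most half its length; hence, writing [U N] for the number
    of unbordered words of length [N] that agree with [p] and [m = |p|],
      [k^(N-m) = U N + sum_(1 <= j <= N/2) U j * c N j]   for [N >= m],
    where [c N j] counts the ways to fill the letters not fixed by [p] and by the two
    copies of the border.  If [p] reaches into the second copy, [c N j] is [0] or [1]
    according to whether [p] has period [N - j]; with [p] stored as an integer in base
    [k] this is one division and one remainder, so that one prefix costs [O(n^2)].
    For [j < m] the values [U j] depend on [w_1 ... w_(i-1)] only and are left in the
    table by the preceding position. *)

(** * Counting unbordered words with a given prefix *)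

Definition letter (k a : nat) : bool := (1 <= a) && (a <= k).

(* One of [p] and [u] is a prefix of the other. *)
Definition compatible (p u : seq nat) : bool := take (size u) p == take (size p) u.

(** For [j < size p] and [p] over the alphabet, this only tests whether the length-[j] prefix of [p]
    is unbordered; the recurrence then treats short and long borders alike. *)
Definition numU (k : nat) (p : seq nat) (j : nat) : nat :=
  count (fun u => unbordered u && compatible p u) (words k j).

(** The letter [a] becomes the digit [a - 1]; as the letter [1] is the digit [0], codes separate
    only words of equal length. *)
Definition enc (k : nat) : seq nat -> nat := foldl (fun v a => v * k + a.-1) 0.

(** * Enumeration of the words of a given length *)

Lemma big_words_cat k a b (G : seq nat -> nat) :
  \sum_(u <- words k (a + b)) G u =
  \sum_(x <- words k a) \sum_(y <- words k b) G (x ++ y).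
Proof.
elim: a G => [|a IH] G; first by rewrite big_seq1.
by rewrite addSn /= !big_allpairs_dep /=; apply: eq_bigr => i _; rewrite IH.
Qed.

Lemma mem_words k n u : (u \in words k n) = (size u == n) && all (letter k) u.
Proof.
elim: n u => [|n IH] [|a u]; rewrite /= ?inE ?eqSS //.
  by apply/allpairsP => -[[? ?] [_ _ ]].
apply/allpairsP/idP => [[[b v] /= [bk vw [-> ->]]]|/andP [su /andP [la lu]]].
  by move: vw bk; rewrite IH mem_iota /letter => /andP [-> ->]; lia.
exists (a, u); split=> //=; last by rewrite IH su.
by move: la; rewrite mem_iota /letter; lia.
Qed.

Lemma words_uniq k n : uniq (words k n).
Proof.
elim: n => //= n IH; apply: allpairs_uniq => //; first exact: iota_uniq.
by move=> [a u] [b v] _ _ /= [-> ->].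
Qed.

Lemma size_words k n : size (words k n) = k ^ n.
Proof. by elim: n => //= n IH; rewrite size_allpairs size_iota IH expnS. Qed.

Lemma countE (T : Type) (P : pred T) (s : seq T) : count P s = \sum_(x <- s) P x.
Proof. by rewrite -sum1_count big_mkcond; apply: eq_bigr => x _; case: (P x). Qed.

Lemma sum_eq_words k j x (c : nat) : x \in words k j ->
  \sum_(z <- words k j) (x == z) * c = c.
Proof.
move=> xw; rewrite -big_distrl /= -countE.
have -> : count (fun z => x == z) (words k j) = count_mem x (words k j).
  by apply: eq_count => z /=; rewrite eq_sym.
by rewrite (count_uniq_mem _ (words_uniq k j)) xw mul1n.
Qed.

(** * Borders and the unbordered border *)

Definition isborder (i : nat) (u : seq nat) : bool := take i u == drop (size u - i) u.

Lemma isborderP i u : i <= size u ->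
  reflect (forall t, t < i -> nth 0 u t = nth 0 u (size u - i + t)) (isborder i u).
Proof.
move=> li; apply: (iffP eqP) => [e t lt|h].
  by rewrite -nth_drop -e nth_take.
apply: (@eq_from_nth _ 0) => [|t]; first by rewrite size_take size_drop; case: ltnP => ?; lia.
rewrite size_takel // => lt; rewrite nth_take // nth_drop; exact: h.
Qed.

Lemma borderedP u : reflect (exists2 i, 0 < i < size u & isborder i u) (bordered u).
Proof.
apply: (iffP hasP) => [[i]|[i lti bi]]; first by rewrite mem_iota => hi bi; exists i; first lia.
by exists i => //; rewrite mem_iota; lia.
Qed.

(** The length-[i] suffix of [u] lies inside the second copy of the border of length [j], so it is
    also the suffix of the first copy. *)
Lemma border_of_border i j u : i < j -> j <= size u -> isborder j u ->
  isborder i (take j u) = isborder i u.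
Proof.
move=> lij lj /(isborderP lj) bj.
have sj : size (take j u) = j by rewrite size_takel.
apply/isborderP/isborderP; rewrite ?sj; try lia; move=> h t lt.
- have := h t lt; rewrite nth_take ?nth_take; try lia; move=> ->.
  by rewrite bj; [congr nth; lia | lia].
- rewrite nth_take ?nth_take; try lia; rewrite h // (bj (j - i + t)); last lia.
  by congr nth; lia.
Qed.

(** The two copies share a factor of length [2j - |u|]: it starts the second copy, hence is a prefix
    of [u], and it ends the first copy, hence is a suffix of [u]. *)
Lemma overlapping_border j u : j < size u -> size u < j.*2 -> isborder j u ->
  isborder (j.*2 - size u) u.
Proof.
move=> lj l2 /(isborderP (ltnW lj)) bj; apply/isborderP => [|t lt]; first lia.
rewrite bj; last lia; rewrite bj; last lia.
by congr nth; lia.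
Qed.

(* The unbordered border is the shortest one; its two occurrences do not overlap, since an
   overlap would be a shorter border. *)
Lemma sum_unbordered_borders u :
  \sum_(1 <= j < (size u)./2.+1) (isborder j u && unbordered (take j u)) = bordered u.
Proof.
rewrite -countE; case: (boolP (bordered u)) => [bu|nbu]; last first.
  apply/eqP; rewrite eqn0Ngt -has_count; apply/hasP => -[j].
  rewrite mem_index_iota => lj /andP [bj _]; case/borderedP: nbu.
  by exists j => //; lia.
have ex : exists i, (0 < i < size u) && isborder i u.
  by case/borderedP: bu => i h1 h2; exists i; rewrite h1.
case: (ex_minnP ex) => j /andP [lj bj] jmin.
have lj2 : j <= (size u)./2.
  case: (leqP j (size u)./2) => // l2.
  have := @overlapping_border j u; move/(_ ltac:(lia) ltac:(lia) bj) => b2.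
  by have := jmin (j.*2 - size u); rewrite b2; lia.
have uj : unbordered (take j u).
  apply/borderedP => -[i]; rewrite size_takel; last lia.
  move=> li; rewrite border_of_border //; try lia; move=> bi.
  by have := jmin i; rewrite bi; lia.
(* A border longer than the shortest one has the shortest one as a border, so it is not unbordered;
   only [j] is counted. *)
have -> : count (fun i => isborder i u && unbordered (take i u)) (index_iota 1 (size u)./2.+1)
   = count_mem j (index_iota 1 (size u)./2.+1).
  apply: eq_in_count => i /=; rewrite mem_index_iota => li.
  apply/andP/eqP => [[bi ui]|->//].
  case: (ltngtP i j) => // lij.
    by have := jmin i; rewrite bi; lia.
  case/borderedP: ui; exists j; rewrite ?size_takel; try lia.
  by rewrite border_of_border //; lia.
rewrite (count_uniq_mem _ (iota_uniq _ _)) mem_index_iota; lia.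
Qed.

(** * The recurrence for unbordered words with a given prefix *)

Lemma prefix_cat_le (p x z : seq nat) : size p <= size x -> prefix p (x ++ z) = prefix p x.
Proof. by move=> l; rewrite !prefixE takel_cat. Qed.

Lemma prefix_cat_ge (p x z : seq nat) : size x <= size p ->
  prefix p (x ++ z) = (take (size x) p == x) && prefix (drop (size x) p) z.
Proof.
move=> l; rewrite -{1}(cat_take_drop (size x) p) !prefixE size_cat size_drop size_takel //.
rewrite take_cat ltnNge leq_addr /= addKn.
by rewrite eqseq_cat ?size_takel // eq_sym.
Qed.

Lemma count_prefix_words k (q : seq nat) L : all (letter k) q -> size q <= L ->
  count (prefix q) (words k L) = k ^ (L - size q).
Proof.
move=> lq lL; rewrite countE -{1}(subnKC lL) big_words_cat.
transitivity (\sum_(x <- words k (size q)) (q == x) * k ^ (L - size q)); last first.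
  by apply: sum_eq_words; rewrite mem_words eqxx.
rewrite !big_seq; apply: eq_bigr => x; rewrite mem_words => /andP [/eqP sx _].
under eq_bigr => y _ do rewrite prefix_cat_le ?sx // prefixE -sx take_size eq_sym.
by rewrite big_const_seq count_predT size_words iter_addn_0.
Qed.

Lemma compatible_prefix p u : size p <= size u -> compatible p u = prefix p u.
Proof. by move=> l; rewrite /compatible take_oversize // prefixE eq_sym. Qed.

Lemma compatible_take p u : size u <= size p -> compatible p u = (take (size u) p == u).
Proof. by move=> l; rewrite /compatible (take_oversize l). Qed.

(** The cases are where [p] ends in [x ++ y ++ x]. If it ends in the first [x] or in [y], the
    equality test compares empty words and the exponent counts the free letters of [y]; if it ends
    in the second [x], then [y] is forced and [p] must have period [N - j]. *)
Lemma sum_prefix_bracket k p N j x : all (letter k) p -> size p <= N -> j.*2 <= N ->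
  x \in words k j ->
  \sum_(y <- words k (N - j.*2)) prefix p (x ++ y ++ x) =
  compatible p x *
  ((drop (N - j) p == take (size p - (N - j)) p) * k ^ (N - j - size p - (j - size p))).
Proof.
move=> lp lm l2; rewrite mem_words => /andP [/eqP sx lx].
case: (leqP (size p) j) => [lj|lj].
  rewrite compatible_prefix ?sx //.
  rewrite drop_oversize; last lia.
  have -> : size p - (N - j) = 0 by lia.
  rewrite take0 eqxx mul1n.
  under eq_bigr => y _ do rewrite prefix_cat_le ?sx //.
  rewrite big_const_seq count_predT size_words iter_addn_0; congr (_ * _ ^ _); lia.
rewrite compatible_take ?sx; last lia.
have lxp : size x <= size p by lia.
under eq_bigr => y _ do rewrite (prefix_cat_ge _ lxp) sx.
case: eqP => [ex|_] /=; last by rewrite big1.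
rewrite mul1n.
case: (leqP (size p) (N - j)) => l3.
  rewrite (@drop_oversize _ (N - j)) //.
  have -> : size p - (N - j) = 0 by lia.
  rewrite take0 eqxx mul1n.
  transitivity (count (prefix (drop j p)) (words k (N - j.*2))).
    rewrite countE !big_seq; apply: eq_bigr => y; rewrite mem_words => /andP [/eqP sy _].
    by rewrite prefix_cat_le // size_drop sy; lia.
  rewrite count_prefix_words ?size_drop; last lia.
    by congr (_ ^ _); lia.
  by move: lp; rewrite -{1}(cat_take_drop j p) all_cat => /andP [].
have -> : N - j - size p - (j - size p) = 0 by lia.
rewrite expn0 muln1.
transitivity (\sum_(y <- words k (N - j.*2))
   (take (N - j.*2) (drop j p) == y) * (drop (N - j) p == take (size p - (N - j)) p)).
  rewrite !big_seq; apply: eq_bigr => y; rewrite mem_words => /andP [/eqP sy _].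
  rewrite prefix_cat_ge ?size_drop ?sy; last lia.
  have eN : N - j.*2 + j = N - j by lia.
  have lj2 : size p - (N - j) <= j by lia.
  rewrite drop_drop eN prefixE size_drop -ex take_takel //.
  by rewrite mulnb [X in _ && X]eq_sym.
have lL : N - j.*2 <= size (drop j p) by rewrite size_drop; lia.
apply: sum_eq_words; rewrite mem_words size_takel //.
rewrite eqxx /=; apply/allP => a /mem_take /mem_drop; exact: (allP lp).
Qed.

Lemma numU_recurrence k p N : all (letter k) p -> size p <= N ->
  k ^ (N - size p) = numU k p N + \sum_(1 <= j < N./2.+1) numU k p j *
    ((drop (N - j) p == take (size p - (N - j)) p) * k ^ (N - j - size p - (j - size p))).
Proof.
move=> lp lN; rewrite -(count_prefix_words lp lN) countE.
transitivity (\sum_(u <- words k N) ((unbordered u && compatible p u) +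
   \sum_(1 <= j < N./2.+1) prefix p u * (isborder j u && unbordered (take j u)))).
  rewrite !big_seq; apply: eq_bigr => u; rewrite mem_words => /andP [/eqP su _].
  rewrite -big_distrr /= -su sum_unbordered_borders compatible_prefix ?su //.
  by rewrite /unbordered; case: (bordered u); case: prefix.
rewrite big_split /= /numU -countE exchange_big /=; congr (_ + _).
rewrite !big_nat; apply: eq_bigr => j lj.
rewrite countE big_distrl /=.
(* Words are split as [x ++ y ++ z] with [|x| = |z| = j]; [sum_eq_words], read backwards, supplies
   the sum over [z], in which only [z = x] survives. *)
have -> : N = j + ((N - j.*2) + j) by lia.
rewrite big_words_cat !big_seq; apply: eq_bigr => x xw.
have -> : j + ((N - j.*2) + j) = N by lia.
have /andP [/eqP sx _] : (size x == j) && all (letter k) x by rewrite -mem_words.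
rewrite big_words_cat -mulnb -mulnA -sum_prefix_bracket //; last lia.
rewrite big_distrr /= !big_seq; apply: eq_bigr => y.
rewrite mem_words => /andP [/eqP sy _].
rewrite -(sum_eq_words (unbordered x * prefix p (x ++ y ++ x)) xw) !big_seq.
apply: eq_bigr => z; rewrite mem_words => /andP [/eqP sz _].
rewrite /isborder -sx take_size_cat // catA !size_cat sx sy sz.
have -> : j + (N - j.*2) + j - j = size (x ++ y) by rewrite size_cat sx sy; lia.
rewrite drop_size_cat // -catA; case: eqP => [->|_]; last by rewrite muln0.
by rewrite mul1n mulnC.
Qed.

(** * Words as integers in base [k] *)

Lemma enc_rcons k x a : enc k (rcons x a) = enc k x * k + a.-1.
Proof. exact: foldl_rcons. Qed.

Lemma enc_cat k x y : enc k (x ++ y) = enc k x * k ^ size y + enc k y.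
Proof.
elim/last_ind: y => [|y a IH]; first by rewrite cats0 muln1 addn0.
rewrite -rcons_cat !enc_rcons IH size_rcons expnS.
by rewrite mulnDl addnA -mulnA (mulnC k).
Qed.

Lemma enc_lt k x : all (letter k) x -> enc k x < k ^ size x.
Proof.
elim/last_ind: x => // x a IH; rewrite all_rcons => /andP [la /IH h].
rewrite enc_rcons size_rcons expnS.
move: la; rewrite /letter; nia.
Qed.

Lemma enc_inj k x y : all (letter k) x -> all (letter k) y -> size x = size y ->
  enc k x = enc k y -> x = y.
Proof.
elim/last_ind: x y => [|x a IH] y.
  by case: y.
case/lastP: y => [|y b]; first by rewrite size_rcons.
rewrite !all_rcons !size_rcons => /andP [la lx] /andP [lb ly] [sxy].
rewrite !enc_rcons => e.
move: la lb; rewrite /letter => la lb.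
have kp : 0 < k by lia.
have e1 : enc k x = enc k y.
  have := congr1 (divn^~ k) e; rewrite /= !divnMDl // !divn_small; lia.
rewrite (IH y) //; congr rcons; lia.
Qed.

(* Uniform in [d]: for [d >= size p] both sides are true, by truncated subtraction on the
   right and because [enc k p < k ^ d] on the left. *)
Lemma enc_self_overlap k p d : 0 < k -> all (letter k) p ->
  (enc k p %% k ^ (size p - d) == enc k p %/ k ^ d) =
  (drop d p == take (size p - d) p).
Proof.
move=> kp lp.
have ltk e : all (letter k) (take e p) by apply/allP => a /mem_take; apply: (allP lp).
have ldr e : all (letter k) (drop e p) by apply/allP => a /mem_drop; apply: (allP lp).
have -> : enc k p %% k ^ (size p - d) = enc k (drop d p).
  rewrite -{1}(cat_take_drop d p) enc_cat size_drop modnMDl modn_small //.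
  by rewrite -(size_drop d p) enc_lt.
have -> : enc k p %/ k ^ d = enc k (take (size p - d) p).
  case: (leqP d (size p)) => ld.
    rewrite -{1}(cat_take_drop (size p - d) p) enc_cat size_drop subKn //.
    rewrite divnMDl ?expn_gt0 ?kp // divn_small ?addn0 //.
    by have := enc_lt (ldr (size p - d)); rewrite size_drop subKn.
  have -> : size p - d = 0 by lia.
  rewrite take0 divn_small //; apply: leq_trans (enc_lt lp) _.
  by rewrite leq_pexp2l // ltnW.
apply/eqP/eqP => [|->//]; apply: enc_inj => //.
rewrite size_drop size_takel //; lia.
Qed.

(* The subtractions are truncated: with [m = size p], the exponent is
   [N - j - maxn m j], and [0] when [p] reaches into the second copy of the border. *)
Definition coef k p N j : nat :=
  (enc k p %% k ^ (size p - (N - j)) == enc k p %/ k ^ (N - j)) *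
  k ^ (N - j - size p - (j - size p)).

(** The subtraction loses nothing, since by the recurrence the sum is one of the two parts of the
    power. Only [j <= N/2] occurs, so a table can be filled in increasing order of [N]. *)
Lemma numU_rec k p N : 0 < k -> all (letter k) p -> size p <= N ->
  numU k p N = k ^ (N - size p) - \sum_(1 <= j < N./2.+1) numU k p j * coef k p N j.
Proof.
move=> kp lp lN; rewrite (numU_recurrence lp lN).
under [X in _ - X]eq_bigr => j _ do rewrite /coef enc_self_overlap //.
by rewrite addnK.
Qed.

Lemma numU_eq k p q j : j <= size p -> j <= size q -> take j p = take j q ->
  numU k p j = numU k q j.
Proof.
move=> lp lq e; apply: eq_in_count => u; rewrite mem_words => /andP [/eqP su _].
by rewrite !compatible_take ?su // e.
Qed.

(** At most one term is 1: [i] is the first position where the words differ and [t.+1] is the letter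
    of [u] there. Equal lengths exclude the proper-prefix case of the order. *)
Lemma lexlt_sum u w : size u = size w -> all (leq 1) u ->
  lexlt u w = \sum_(0 <= i < size w) \sum_(0 <= t < (nth 0 w i).-1)
     prefix (rcons (take i w) t.+1) u :> nat.
Proof.
elim: w u => [|c w IH] [|b u] //=; first by rewrite big_geq.
case=> su /andP [lb lu].
rewrite big_nat_recl // /=.
have -> : \sum_(0 <= t < c.-1) ((t.+1 == b) && prefix [::] u : nat) = (b < c).
  transitivity (count_mem b.-1 (index_iota 0 c.-1)).
    by rewrite countE; apply: eq_bigr => t _; rewrite prefix0s andbT /=; congr nat_of_bool; apply/eqP/eqP; lia.
  by rewrite (count_uniq_mem _ (iota_uniq _ _)) mem_index_iota; lia.
have -> : \sum_(0 <= i < size w) \sum_(0 <= t < (nth 0 w i).-1)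
    ((c == b) && prefix (rcons (take i w) t.+1) u : nat) = (c == b) * lexlt u w.
  rewrite (IH u) // big_distrr /=; apply: eq_bigr => i _.
  by rewrite big_distrr /=; apply: eq_bigr => t _; rewrite mulnb.
by rewrite (eq_sym c); case: ltngtP => //= _; rewrite ?mul1n.
Qed.

Lemma rankU_sum k w : rankU k w = 1 + \sum_(0 <= i < size w)
  \sum_(0 <= t < (nth 0 w i).-1) numU k (rcons (take i w) t.+1) (size w).
Proof.
congr (_ + _); rewrite countE.
transitivity (\sum_(u <- words k (size w)) \sum_(0 <= i < size w)
  \sum_(0 <= t < (nth 0 w i).-1) (unbordered u && prefix (rcons (take i w) t.+1) u)).
  rewrite !big_seq; apply: eq_bigr => u; rewrite mem_words => /andP [/eqP su lu].
  rewrite -mulnb lexlt_sum //; last by apply: sub_all lu => a /andP [].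
  rewrite big_distrr /=; apply: eq_bigr => i _.
  by rewrite big_distrr /=; apply: eq_bigr => t _; rewrite mulnb.
rewrite exchange_big /= !big_nat; apply: eq_bigr => i /= li.
rewrite exchange_big; apply: eq_bigr => t _.
rewrite /numU countE !big_seq; apply: eq_bigr => u; rewrite mem_words => /andP [/eqP su _].
by rewrite compatible_prefix // size_rcons size_takel ?su; lia.
Qed.

(** * Structured programs for the RAM *)

Inductive cmd :=
| Skip
| Ins of instr
| Seq of cmd & cmd
| While of nat & cmd.

Local Notation "c1 ;; c2" := (Seq c1 c2) (at level 100, c2 at level 200, right associativity).

Fixpoint csize (c : cmd) : nat :=
  match c with
  | Skip => 0
  | Ins _ => 1
  | Seq c1 c2 => csize c1 + csize c2
  | While _ b => (csize b).+2
  end.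

Fixpoint compile (off : nat) (c : cmd) : seq instr :=
  match c with
  | Skip => [::]
  | Ins i => [:: i]
  | Seq c1 c2 => compile off c1 ++ compile (off + csize c1) c2
  | While r b =>
      IJz r (off + (csize b).+2) :: compile off.+1 b ++ [:: IJmp off]
  end.

Lemma size_compile off c : size (compile off c) = csize c.
Proof.
elim: c off => [|i|c1 IH1 c2 IH2|r b IH] off //=; first by rewrite size_cat IH1 IH2.
by rewrite size_cat IH addn1.
Qed.

(* Stated in continuation style: [t] steps lead from [(pc, m)] to [(pc', m')] and
   access only registers below [s]. *)
Definition reach s p pc m t pc' m' : Prop :=
  forall f T S mf, run f p pc' m' = Some (T, S, mf) ->
  exists S', run (t + f) p pc m = Some (t + T, S', mf) /\ S' <= maxn s S.

Lemma reach0 s p pc m : reach s p pc m 0 pc m.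
Proof. by move=> f T S mf ->; exists S; split=> //; rewrite leq_maxr. Qed.

Lemma reach_step s p pc m a pc1 m1 t pc' m' :
  step p pc m = Some (pc1, m1, a) -> a < s ->
  reach s p pc1 m1 t pc' m' -> reach s p pc m t.+1 pc' m'.
Proof.
move=> st las r f T S mf /r [S' [e leS]].
by rewrite addSn /= st e; exists (maxn a.+1 S'); split=> //; lia.
Qed.

Lemma reach_trans s p pc m t pc1 m1 t' pc' m' :
  reach s p pc m t pc1 m1 -> reach s p pc1 m1 t' pc' m' ->
  reach s p pc m (t + t') pc' m'.
Proof.
move=> r1 r2 f T S mf /r2 [S1 [/r1 [S2 [e2 le2]] le1]].
by exists S2; rewrite -!addnA e2; split=> //; lia.
Qed.

Definition nreg := 22.

(* Registers below [nreg] are the scalar variables [rs] of the program; the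
   addresses above hold its arrays. *)
Definition memory (rs : seq nat) (A : nat -> nat) : nat -> nat :=
  fun i => if i < nreg then nth 0 rs i else A i.

Lemma memory_low rs A i : i < nreg -> memory rs A i = nth 0 rs i.
Proof. by rewrite /memory => ->. Qed.

Lemma memory_high rs A i : nreg <= i -> memory rs A i = A i.
Proof. by rewrite /memory leqNgt; case: ltnP. Qed.

Lemma upd_low m rs A d v : m =1 memory rs A -> d < nreg ->
  upd m d v =1 memory (set_nth 0 rs d v) A.
Proof.
by move=> e ld i; rewrite /upd /memory nth_set_nth /= e /memory; case: eqP => [->|//]; rewrite ld.
Qed.

Lemma upd_high m rs A d v : m =1 memory rs A -> nreg <= d ->
  upd m d v =1 memory rs (upd A d v).
Proof.
move=> e ld i; rewrite /upd /memory e /memory; case: eqP => [->|//].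
by rewrite ltnNge ld.
Qed.

(** A total-correctness Hoare triple with time bound [T] and space bound [s]. Jump targets are
    absolute, so the code is compiled for its place between arbitrary [p1] and [p2]; memories are
    compared pointwise. *)
Definition spec s c T rs A (Q : seq nat -> (nat -> nat) -> Prop) : Prop :=
  forall p1 p2 m, m =1 memory rs A ->
  exists t m' rs' A', [/\ t <= T, m' =1 memory rs' A', Q rs' A' &
    reach s (p1 ++ compile (size p1) c ++ p2) (size p1) m t
          (size p1 + csize c) m'].

Lemma spec_weaken s c T T' rs A (Q Q' : seq nat -> (nat -> nat) -> Prop) :
  spec s c T rs A Q -> T <= T' -> (forall rs A, Q rs A -> Q' rs A) ->
  spec s c T' rs A Q'.
Proof.
move=> sp le imp p1 p2 m /(sp p1 p2) [t [m' [rs' [A' [h1 h2 h3 h4]]]]].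
by exists t, m', rs', A'; split=> //; [lia | apply: imp].
Qed.

Lemma spec_time s c T T' rs A (Q : seq nat -> (nat -> nat) -> Prop) :
  spec s c T rs A Q -> T <= T' -> spec s c T' rs A Q.
Proof. by move=> h1 h2; apply: spec_weaken h1 h2 _. Qed.

Lemma spec_skip s rs A (Q : seq nat -> (nat -> nat) -> Prop) :
  Q rs A -> spec s Skip 0 rs A Q.
Proof.
move=> q p1 p2 m e; exists 0, m, rs, A; split=> //.
by rewrite addn0; apply: reach0.
Qed.

Lemma spec_seq s c1 c2 T1 T2 rs A Q1 Q2 :
  spec s c1 T1 rs A Q1 -> (forall rs' A', Q1 rs' A' -> spec s c2 T2 rs' A' Q2) ->
  spec s (c1 ;; c2) (T1 + T2) rs A Q2.
Proof.
move=> s1 s2 p1 p2 m /(s1 p1 (compile (size p1 + csize c1) c2 ++ p2)).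
move=> [t1 [m1 [rs1 [A1 [l1 e1 q1 r1]]]]].
have := s2 _ _ q1 (p1 ++ compile (size p1) c1) p2 m1 e1.
move=> [t2 [m2 [rs2 [A2 [l2 e2 q2 r2]]]]].
exists (t1 + t2), m2, rs2, A2; split=> //; first lia.
rewrite /= -catA; apply: reach_trans r1 _.
by move: r2; rewrite size_cat size_compile -!catA addnA.
Qed.

Lemma nth_code p1 i p2 : nth IHalt (p1 ++ i :: p2) (size p1) = i.
Proof. by rewrite nth_cat ltnn subnn. Qed.

Lemma spec_ins s i a c T rs A rs1 A1 Q :
  (forall p pc m, m =1 memory rs A -> nth IHalt p pc = i ->
     exists2 m1, m1 =1 memory rs1 A1 & step p pc m = Some (pc.+1, m1, a)) ->
  a < s -> spec s c T rs1 A1 Q -> spec s (Ins i ;; c) T.+1 rs A Q.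
Proof.
move=> hst las sp; rewrite -addn1 addnC.
apply: (@spec_seq _ _ _ _ _ _ _ (fun rs' A' => rs' = rs1 /\ A' = A1)); last by move=> _ _ [-> ->].
move=> p1 p2 m /(hst (p1 ++ i :: p2) (size p1)).
case; first exact: nth_code.
move=> m1 e1 st; exists 1, m1, rs1, A1; split=> //=.
apply: reach_step st las _; rewrite addn1; exact: reach0.
Qed.

(** * Rules for single instructions *)

Section Rules.
Variable s : nat.
Hypothesis s_ge : nreg <= s.
Variables (c : cmd) (T : nat) (rs : seq nat) (A : nat -> nat).
Variable Q : seq nat -> (nat -> nat) -> Prop.

Lemma spec_const d v : d < nreg ->
  spec s c T (set_nth 0 rs d v) A Q -> spec s (Ins (IConst d v) ;; c) T.+1 rs A Q.
Proof.
move=> ld; apply: (@spec_ins _ _ d); last lia.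
move=> p pc m e h; rewrite /step h; eexists; last by [].
exact: upd_low.
Qed.

Let lt3 d a b : [&& d < nreg, a < nreg & b < nreg] -> maxn d (maxn a b) < s.
Proof. by move=> /and3P [? ? ?]; rewrite !gtn_max !(leq_trans _ s_ge). Qed.

Lemma spec_add d a b : [&& d < nreg, a < nreg & b < nreg] ->
  spec s c T (set_nth 0 rs d (nth 0 rs a + nth 0 rs b)) A Q ->
  spec s (Ins (IAdd d a b) ;; c) T.+1 rs A Q.
Proof.
move=> l; have := lt3 l; apply: spec_ins => p pc m e h; rewrite /step h.
eexists; last by []. case/and3P: l => ld la lb.
by rewrite !e !memory_low //; apply: upd_low.
Qed.

Lemma spec_sub d a b : [&& d < nreg, a < nreg & b < nreg] ->
  spec s c T (set_nth 0 rs d (nth 0 rs a - nth 0 rs b)) A Q ->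
  spec s (Ins (ISub d a b) ;; c) T.+1 rs A Q.
Proof.
move=> l; have := lt3 l; apply: spec_ins => p pc m e h; rewrite /step h.
eexists; last by []. case/and3P: l => ld la lb.
by rewrite !e !memory_low //; apply: upd_low.
Qed.

Lemma spec_mul d a b : [&& d < nreg, a < nreg & b < nreg] ->
  spec s c T (set_nth 0 rs d (nth 0 rs a * nth 0 rs b)) A Q ->
  spec s (Ins (IMul d a b) ;; c) T.+1 rs A Q.
Proof.
move=> l; have := lt3 l; apply: spec_ins => p pc m e h; rewrite /step h.
eexists; last by []. case/and3P: l => ld la lb.
by rewrite !e !memory_low //; apply: upd_low.
Qed.

Lemma spec_div d a b : [&& d < nreg, a < nreg & b < nreg] ->
  spec s c T (set_nth 0 rs d (nth 0 rs a %/ nth 0 rs b)) A Q ->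
  spec s (Ins (IDiv d a b) ;; c) T.+1 rs A Q.
Proof.
move=> l; have := lt3 l; apply: spec_ins => p pc m e h; rewrite /step h.
eexists; last by []. case/and3P: l => ld la lb.
by rewrite !e !memory_low //; apply: upd_low.
Qed.

Lemma spec_mod d a b : [&& d < nreg, a < nreg & b < nreg] ->
  spec s c T (set_nth 0 rs d (nth 0 rs a %% nth 0 rs b)) A Q ->
  spec s (Ins (IMod d a b) ;; c) T.+1 rs A Q.
Proof.
move=> l; have := lt3 l; apply: spec_ins => p pc m e h; rewrite /step h.
eexists; last by []. case/and3P: l => ld la lb.
by rewrite !e !memory_low //; apply: upd_low.
Qed.

(** The address may be that of a scalar register: [copy_body] reads letters of the input that still
    lie there. *)
Lemma spec_load v d a : (d < nreg) && (a < nreg) -> nth 0 rs a < s ->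
  memory rs A (nth 0 rs a) = v ->
  spec s c T (set_nth 0 rs d v) A Q -> spec s (Ins (ILoad d a) ;; c) T.+1 rs A Q.
Proof.
move=> /andP [ld la] las ev; apply: (@spec_ins _ _ (maxn d (maxn a (nth 0 rs a)))); last first.
  by rewrite !gtn_max las !(leq_trans _ s_ge).
move=> p pc m e h; rewrite /step h !e (memory_low _ _ la).
by eexists; last by []; rewrite ev; apply: upd_low.
Qed.

Lemma spec_load_high v d a : (d < nreg) && (a < nreg) -> nreg <= nth 0 rs a < s ->
  A (nth 0 rs a) = v ->
  spec s c T (set_nth 0 rs d v) A Q -> spec s (Ins (ILoad d a) ;; c) T.+1 rs A Q.
Proof.
move=> lda /andP [ge las] ev; apply: spec_load => //.
by rewrite memory_high.
Qed.

Lemma spec_store a r : (a < nreg) && (r < nreg) -> nreg <= nth 0 rs a < s ->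
  spec s c T rs (upd A (nth 0 rs a) (nth 0 rs r)) Q ->
  spec s (Ins (IStore a r) ;; c) T.+1 rs A Q.
Proof.
move=> /andP [la lr] /andP [ge las].
apply: (@spec_ins _ _ (maxn r (maxn a (nth 0 rs a)))); last first.
  by rewrite !gtn_max las !(leq_trans _ s_ge).
move=> p pc m e h; rewrite /step h !e !memory_low //.
by eexists; last by []; apply: upd_high.
Qed.

End Rules.

(** The invariant is indexed by the number of rounds left, which register [r] holds. A round costs
    two steps beyond its body, the test and the jump back; the final test costs one. *)
Lemma spec_while s r b T (I : nat -> seq nat -> (nat -> nat) -> Prop) cnt rs A :
  nreg <= s -> r < nreg ->
  (forall c rs A, I c rs A -> nth 0 rs r = c) ->
  (forall c rs A, I c.+1 rs A -> spec s b T rs A (I c)) ->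
  I cnt rs A -> spec s (While r b) (cnt * T.+2 + 1) rs A (I 0).
Proof.
move=> sge lr Ir Ib; elim: cnt rs A => [|cnt IH] rs A Ic p1 p2 m e.
  exists 1, m, rs, A; split=> //.
  apply: (@reach_step _ _ _ _ r); [| lia | exact: reach0].
  by rewrite /step /= nth_code e memory_low // (Ir _ _ _ Ic).
set p := p1 ++ _.
have pE : p = rcons p1 (IJz r (size p1 + (csize b).+2)) ++
    compile (size (rcons p1 (IJz r (size p1 + (csize b).+2)))) b ++ IJmp (size p1) :: p2.
  by rewrite /p /= -cats1 -!catA size_cat addn1.
have [t [m1 [rs1 [A1 [lt1 e1 q1 r1]]]]] :=
  Ib _ _ _ Ic (rcons p1 (IJz r (size p1 + (csize b).+2))) (IJmp (size p1) :: p2) _ e.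
have [t2 [m2 [rs2 [A2 [lt2 e2 q2 r2]]]]] := IH _ _ q1 p1 p2 _ e1.
exists (t + t2.+1).+1, m2, rs2, A2; split=> //; first lia.
apply: (@reach_step _ _ _ _ r); [| lia |].
  by rewrite /step /p /= nth_code e memory_low // (Ir _ _ _ Ic).
rewrite -/p in r2.
move: r1; rewrite -pE size_rcons => r1.
rewrite (Ir _ _ _ Ic) /=; apply: reach_trans r1 _; apply: (@reach_step _ _ _ _ 0 (size p1) m1) r2; last lia.
rewrite /step pE catA nth_cat size_cat size_compile size_rcons ltnn subnn //.
Qed.

Lemma spec_run s c T rs A Q m fuel : spec s c T rs A Q -> m =1 memory rs A -> T < fuel ->
  exists t s' mf rs' A', [/\ run fuel (compile 0 c ++ [:: IHalt]) 0 m = Some (t, s', mf),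
    t <= T.+1, s' <= s, mf =1 memory rs' A' & Q rs' A'].
Proof.
move=> sp /(sp [::] [:: IHalt]) [t [m' [rs' [A' [lt e q r]]]]] ltT.
have [|S' [e' le']] := r (fuel - t) 1 0 m'.
  have -> : fuel - t = (fuel - t).-1.+1 by lia.
  by rewrite /= /step add0n -(size_compile 0 c) nth_code.
exists (t + 1), S', m', rs', A'; split=> //; try lia.
by rewrite -e'; congr (run _ _ _ _); lia.
Qed.

(** * The ranking program *)

Definition block (l : seq instr) (c : cmd) : cmd := foldr (fun i => Seq (Ins i)) c l.

(** [fB] and [pB] are the base addresses of the [numU] table and of the powers, [wp] that of the
    next letter. [V] and [X] are the codes of the prefix of [w] and of the current [p], [m] is the
    length of [p]; [I], [a], [cN], [cJ] are loop counters. *)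
Module Reg.
Notation K := 0 (only parsing).
Notation n := 1 (only parsing).
Notation one := 2 (only parsing).
Notation fB := 3 (only parsing).
Notation pB := 4 (only parsing).
Notation wp := 5 (only parsing).
Notation acc := 6 (only parsing).
Notation V := 7 (only parsing).
Notation m := 8 (only parsing).
Notation I := 9 (only parsing).
Notation a := 10 (only parsing).
Notation X := 11 (only parsing).
Notation N := 12 (only parsing).
Notation cN := 13 (only parsing).
Notation sum := 14 (only parsing).
Notation j := 15 (only parsing).
Notation cJ := 16 (only parsing).
Notation d := 17 (only parsing).
Notation t1 := 18 (only parsing).
Notation t2 := 19 (only parsing).
Notation t3 := 20 (only parsing).
Notation zero := 21 (only parsing).
End Reg.

(* Adds [U j * c N j] to [sum]; the test [x == y] is computed as
   [1 - ((x - y) + (y - x))]. *)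
Definition term_body : cmd := block [::
  ISub Reg.d Reg.N Reg.j;
  ISub Reg.t1 Reg.m Reg.d;
  IAdd Reg.t1 Reg.t1 Reg.pB;
  ILoad Reg.t1 Reg.t1;
  IMod Reg.t1 Reg.X Reg.t1;
  IAdd Reg.t2 Reg.d Reg.pB;
  ILoad Reg.t2 Reg.t2;
  IDiv Reg.t2 Reg.X Reg.t2;
  ISub Reg.t3 Reg.t1 Reg.t2;
  ISub Reg.t2 Reg.t2 Reg.t1;
  IAdd Reg.t3 Reg.t3 Reg.t2;
  ISub Reg.t3 Reg.one Reg.t3;
  ISub Reg.t2 Reg.d Reg.m;
  ISub Reg.t1 Reg.j Reg.m;
  ISub Reg.t2 Reg.t2 Reg.t1;
  IAdd Reg.t2 Reg.t2 Reg.pB;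
  ILoad Reg.t2 Reg.t2;
  IMul Reg.t3 Reg.t3 Reg.t2;
  IAdd Reg.t1 Reg.j Reg.fB;
  ILoad Reg.t1 Reg.t1;
  IMul Reg.t3 Reg.t1 Reg.t3;
  IAdd Reg.sum Reg.sum Reg.t3;
  IAdd Reg.j Reg.j Reg.one;
  ISub Reg.cJ Reg.cJ Reg.one] Skip.

Definition length_body : cmd := block [::
  IConst Reg.sum 0;
  IConst Reg.j 1;
  IConst Reg.t1 2;
  IDiv Reg.cJ Reg.N Reg.t1]
  (While Reg.cJ term_body ;; block [::
  ISub Reg.t1 Reg.N Reg.m;
  IAdd Reg.t1 Reg.t1 Reg.pB;
  ILoad Reg.t1 Reg.t1;
  ISub Reg.t1 Reg.t1 Reg.sum;
  IAdd Reg.t2 Reg.N Reg.fB;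
  IStore Reg.t2 Reg.t1;
  IAdd Reg.N Reg.N Reg.one;
  ISub Reg.cN Reg.cN Reg.one] Skip).

(** Entries below [m] are already in the table, so only the lengths from [m] to [n] are filled, in
    [n - m + 1] rounds. Adding 1 to [X] passes to the next last letter. *)
Definition letter_body : cmd := block [::
  IAdd Reg.N Reg.m Reg.zero;
  ISub Reg.cN Reg.n Reg.m;
  IAdd Reg.cN Reg.cN Reg.one]
  (While Reg.cN length_body ;; block [::
  IAdd Reg.t1 Reg.n Reg.fB;
  ILoad Reg.t1 Reg.t1;
  IAdd Reg.acc Reg.acc Reg.t1;
  IAdd Reg.X Reg.X Reg.one;
  ISub Reg.a Reg.a Reg.one] Skip).

(* The inner loop also runs for the letter [w_i] itself, which extends the table
   to the next position; its contribution is then taken out of [acc]. *)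
Definition position_body : cmd := block [::
  IAdd Reg.m Reg.m Reg.one;
  ILoad Reg.a Reg.wp;
  IAdd Reg.wp Reg.wp Reg.one;
  IMul Reg.X Reg.V Reg.K]
  (While Reg.a letter_body ;; block [::
  IAdd Reg.t1 Reg.n Reg.fB;
  ILoad Reg.t1 Reg.t1;
  ISub Reg.acc Reg.acc Reg.t1;
  ISub Reg.V Reg.X Reg.one;
  ISub Reg.I Reg.I Reg.one] Skip).

Definition main_loop : cmd := block [::
  IConst Reg.acc 1;
  IConst Reg.V 0;
  IConst Reg.m 0;
  IAdd Reg.I Reg.n Reg.zero]
  (While Reg.I position_body ;; block [::
  IAdd Reg.K Reg.acc Reg.zero] Skip).

Definition power_body : cmd := block [::
  IMul Reg.t1 Reg.t1 Reg.K;
  IAdd Reg.t2 Reg.t2 Reg.one;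
  IStore Reg.t2 Reg.t1;
  ISub Reg.I Reg.I Reg.one] Skip.

Definition powers : cmd := block [::
  IConst Reg.zero 0;
  IConst Reg.t1 1;
  IAdd Reg.t2 Reg.pB Reg.zero;
  IStore Reg.t2 Reg.t1;
  IAdd Reg.I Reg.n Reg.zero]
  (While Reg.I power_body ;; Skip).

(** Register 0 holds 1, registers 1 and 2 point to the last address written and read, and 3 counts
    down. The fifth letter of [w] is in register 6, so no letter still to be copied is
    overwritten. *)
Definition copy_body : cmd := block [::
  IAdd 1 1 0;
  IAdd 2 2 0;
  ILoad 4 2;
  IStore 1 4;
  ISub 3 3 0] Skip.

(* At the start every fixed register but 0 and 1 may hold a letter of [w], so the
   first four letters are saved by straight-line code that uses only those two. *)
Definition relocate : cmd := block [::
  IAdd 1 1 1; IAdd 1 1 1; IAdd 1 1 1; IAdd 1 1 1; IAdd 1 1 1;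
  IStore 1 0;
  IConst 0 1;
  IAdd 1 1 0; IStore 1 2;
  IAdd 1 1 0; IStore 1 3;
  IAdd 1 1 0; IStore 1 4;
  IAdd 1 1 0; IStore 1 5;
  IConst 2 4;
  ISub 5 1 2;
  IConst 4 32;
  IDiv 3 5 4;
  ISub 3 3 2;
  IConst 2 5]
  (While 3 copy_body ;; block [::
  ILoad Reg.K 5;
  IConst 2 32;
  IDiv Reg.n 5 2;
  IConst Reg.one 1;
  IAdd Reg.wp 5 Reg.one;
  IAdd Reg.fB Reg.wp Reg.n;
  IAdd Reg.pB Reg.fB Reg.n;
  IAdd Reg.pB Reg.pB Reg.one] Skip).

(** * Correctness and cost of the program *)

Section Program.
Variables (k n : nat) (w : seq nat).
Hypotheses (n_gt0 : 0 < n) (k_gt0 : 0 < k) (size_w : size w = n).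
Hypothesis letters_w : all (letter k) w.

(** The highest address used is [35 n + 2], that of [k ^ n]; the bound exceeds it and [nreg]. *)
Let s := 64 * n.

Lemma s_ge : nreg <= s. Proof. rewrite /nreg /s; lia. Qed.

(* Layout: the word at [32 n + 1], the table of [numU] at [33 n + 1], the powers of [k]
   at [34 n + 2]; since [n > 0] all lie above the scalar registers. *)
Definition powers_at A := forall e, e <= n -> A (34 * n + 2 + e) = k ^ e.
Definition word_at A := forall i, i < n -> A (32 * n + 1 + i) = nth 0 w i.
Definition table_at A p b := forall j, 0 < j < b -> A (33 * n + 1 + j) = numU k p j.

Definition state wp acc V m I a X N cN sum j cJ d t1 t2 t3 :=
  [:: k; n; 1; 33 * n + 1; 34 * n + 2; wp; acc; V; m; I; a; X; N; cN; sum; j; cJ;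
      d; t1; t2; t3; 0].

Ltac isteps := repeat (first
  [ eapply (spec_const s_ge); [done|]
  | eapply (spec_add s_ge); [done|]
  | eapply (spec_sub s_ge); [done|]
  | eapply (spec_mul s_ge); [done|]
  | eapply (spec_div s_ge); [done|]
  | eapply (spec_mod s_ge); [done|] ]; cbn [set_nth nth]).

Ltac iload v := eapply (@spec_load_high _ s_ge _ _ _ _ _ v);
  [done | cbn [nth]; rewrite /nreg; lia | cbn [nth] | cbn [set_nth nth]].

Lemma term_body_spec wp acc V m I a p N cN sum j cJ d t1 t2 t3 A :
  size p = m -> m <= N <= n -> 0 < j -> j.*2 <= N -> powers_at A -> table_at A p N ->
  spec s term_body 24
    (state wp acc V m I a (enc k p) N cN sum j cJ d t1 t2 t3) A
    (fun rs A' => A' = A /\ exists d t1 t2 t3,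
       rs = state wp acc V m I a (enc k p) N cN (sum + numU k p j * coef k p N j)
              j.+1 (cJ - 1) d t1 t2 t3).
Proof.
move=> sp lN j0 lj pw tb; rewrite /state /term_body /block /=.
have pwE e : e <= n -> A (e + (34 * n + 2)) = k ^ e by rewrite addnC; apply: pw.
isteps; iload (k ^ (m - (N - j))); first by apply: pwE; lia.
isteps; iload (k ^ (N - j)); first by apply: pwE; lia.
isteps; iload (k ^ (N - j - m - (j - m))); first by apply: pwE; lia.
isteps; iload (numU k p j); first by rewrite addnC; apply: tb; lia.
isteps; apply: spec_skip; split=> //.
do 4 eexists; rewrite /state (addn1 j).
have flagE x y : 1 - (x - y + (y - x)) = (x == y) by case: eqP; lia.
by rewrite /coef sp flagE.
Qed.

Lemma length_body_spec wp acc V m I a p N cN sum j cJ d t1 t2 t3 A :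
  size p = m -> all (letter k) p -> 0 < m -> m <= N <= n -> powers_at A -> word_at A -> table_at A p N ->
  spec s length_body (40 * n)
    (state wp acc V m I a (enc k p) N cN sum j cJ d t1 t2 t3) A
    (fun rs A' => [/\ powers_at A', word_at A', table_at A' p N.+1 &
       exists sum j cJ d t1 t2 t3,
       rs = state wp acc V m I a (enc k p) N.+1 (cN - 1) sum j cJ d t1 t2 t3]).
Proof.
move=> sp lp m0 lN pw wd tb; rewrite /state /length_body /block /=.
pose Inv c rs B := B = A /\ exists j d t1 t2 t3, [/\ 0 < j, j + c = N./2.+1 &
  rs = state wp acc V m I a (enc k p) N cN
    (\sum_(1 <= i < j) numU k p i * coef k p N i) j c d t1 t2 t3].
eapply spec_time; first (isteps; eapply spec_seq).
- eapply (@spec_while _ _ _ 24 Inv (N %/ 2)); [exact: s_ge | done | | |].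
  + by move=> c rs B [_ [? [? [? [? [? [_ _ ->]]]]]]].
  + move=> c rs B [-> {B} [j' [d' [t1' [t2' [t3' [j0 jc ->]]]]]]].
    apply: spec_weaken (leqnn _) _; first by apply: term_body_spec => //; lia.
    move=> rs' B [-> [d2 [t12 [t22 [t32 ->]]]]]; split=> //.
    exists j'.+1, d2, t12, t22, t32; split=> //; first lia.
    by rewrite big_nat_recr //= subn1.
  + split=> //; exists 1, d, 2, t2, t3; split=> //; first by rewrite divn2.
    by rewrite big_geq.
- move=> rs B [-> {B} [j' [d' [t1' [t2' [t3' [j0 jc ->]]]]]]].
  rewrite /state.
  isteps; iload (k ^ (N - m)); first by rewrite addnC; apply: pw; lia.
  isteps; eapply (spec_store s_ge); [done | cbn [nth] | cbn [nth]]; first by rewrite /nreg /s; lia.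
  isteps; apply: spec_skip; split.
  + by move=> e le; rewrite /upd; case: eqP => [|_]; [lia | apply: pw].
  + by move=> e le; rewrite /upd; case: eqP => [|_]; [lia | apply: wd].
  + move=> i li; rewrite /upd; case: eqP => [e|ne]; last by apply: tb; lia.
    have -> : i = N by lia.
    rewrite numU_rec ?sp //; last lia.
    by have -> : j' = N./2.+1 by lia.
  + by do 7 eexists; rewrite /state (addn1 N).
- rewrite divn2; nia.
Qed.

(** Entries up to [b] see only the first [b] letters; this hands the table on from one last letter
    to the next, and from one position to the next. *)
Lemma table_eq A p q b : b <= size p -> b <= size q -> take b p = take b q ->
  table_at A p b.+1 -> table_at A q b.+1.
Proof.
move=> lp lq e tb j lj; rewrite tb //; apply: numU_eq; try lia.
have := congr1 (take j) e; rewrite !take_takel //; lia.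
Qed.

Lemma letter_body_spec wp acc V I a p N cN sum j cJ d t1 t2 t3 A :
  0 < size p <= n -> all (letter k) p -> powers_at A -> word_at A -> table_at A p (size p) ->
  spec s letter_body (60 * n ^ 2)
    (state wp acc V (size p) I a (enc k p) N cN sum j cJ d t1 t2 t3) A
    (fun rs A' => [/\ powers_at A', word_at A', table_at A' p n.+1 &
       exists N cN sum j cJ d t1 t2 t3,
       rs = state wp (acc + numU k p n) V (size p) I (a - 1) (enc k p).+1 N cN sum j cJ d t1 t2 t3]).
Proof.
move=> sp lp pw wd tb; rewrite /state /letter_body /block /=.
pose Inv c rs B := [/\ powers_at B, word_at B &
  exists N sum j cJ d t1 t2 t3, [/\ size p <= N, N + c = n.+1, table_at B p N &
  rs = state wp acc V (size p) I a (enc k p) N c sum j cJ d t1 t2 t3]].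
eapply spec_time; first (isteps; eapply spec_seq).
- eapply (@spec_while _ _ _ (40 * n) Inv (n - size p + 1)); [exact: s_ge | done | | |].
  + by move=> c rs B [_ _ [? [? [? [? [? [? [? [? [_ _ _ ->]]]]]]]]]].
  + move=> c rs B [pB wB [N' [s' [j' [cJ' [d' [t1' [t2' [t3' [lN' eN' tB ->]]]]]]]]]].
    apply: spec_weaken (leqnn _) _; first by apply: length_body_spec => //; lia.
    move=> rs' B' [pB' wB' tB' [s2 [j2 [cJ2 [d2 [t12 [t22 [t32 ->]]]]]]]]; split=> //.
    exists N'.+1, s2, j2, cJ2, d2, t12, t22, t32; rewrite subn1; split=> //; lia.
  + split=> //; exists (size p), sum, j, cJ, d, t1, t2, t3; split=> //; first lia.
    by rewrite addn0.
- move=> rs B [pB wB [N' [s' [j' [cJ' [d' [t1' [t2' [t3' [lN' eN' tB ->]]]]]]]]]].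
  have eN : N' = n.+1 by lia. rewrite {}eN in tB *.
  rewrite /state; isteps; iload (numU k p n); first by rewrite addnC; apply: tB; lia.
  isteps; apply: spec_skip; split=> //.
  by do 9 eexists; rewrite /state (addn1 (enc k p)).
- nia.
Qed.

Lemma position_body_spec i wp acc I a X N cN sum j cJ d t1 t2 t3 A :
  i < n -> wp = 32 * n + 1 + i -> powers_at A -> word_at A -> table_at A w i.+1 ->
  spec s position_body (100 * (k * n ^ 2))
    (state wp acc (enc k (take i w)) i I a X N cN sum j cJ d t1 t2 t3) A
    (fun rs A' => [/\ powers_at A', word_at A', table_at A' w i.+2 &
       exists a X N cN sum j cJ d t1 t2 t3,
       rs = state wp.+1
          (acc + \sum_(0 <= t < (nth 0 w i).-1) numU k (rcons (take i w) t.+1) n)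
          (enc k (take i.+1 w)) i.+1 (I - 1) a X N cN sum j cJ d t1 t2 t3]).
Proof.
move=> li -> pw wd tb; rewrite /state /position_body /block /=.
set q := take i w; set wi := nth 0 w i.
have sq : size q = i by rewrite size_takel //; lia.
have lq : all (letter k) q by apply/allP => x /mem_take; apply: (allP letters_w).
have lwi : letter k wi by apply: (allP letters_w); rewrite mem_nth // size_w.
have qE : rcons q wi = take i.+1 w by rewrite (take_nth 0) // size_w.
(* After [t > 0] letters the table is complete for the last letter [t]; its entries up to [i] are
   those of [w] for every [t]. *)
pose Inv c rs B := [/\ powers_at B, word_at B, table_at B w i.+1 &
  exists t N cN sum j cJ d t1 t2 t3, [/\ t + c = wi,
    0 < t -> table_at B (rcons q t) n.+1 &
  rs = state (32 * n + 1 + i).+1 (acc + \sum_(0 <= u < t) numU k (rcons q u.+1) n)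
    (enc k q) i.+1 I c (enc k q * k + t) N cN sum j cJ d t1 t2 t3]].
eapply spec_time; first (isteps; iload wi; [exact: wd | isteps; eapply spec_seq]).
- eapply (@spec_while _ _ _ (60 * n ^ 2) Inv wi); [exact: s_ge | done | | |].
  + by move=> c rs B [_ _ _ [? [? [? [? [? [? [? [? [? [? [_ _ ->]]]]]]]]]]]].
  + move=> c rs B [pB wB tB [t [N' [cN' [s' [j' [cJ' [d' [t1' [t2' [t3' [et _ ->]]]]]]]]]]]].
    have sp : size (rcons q t.+1) = i.+1 by rewrite size_rcons sq.
    have -> : enc k q * k + t = enc k (rcons q t.+1) by rewrite enc_rcons.
    have tk : take i (rcons q t.+1) = take i w.
      by rewrite -cats1 takel_cat ?sq // -sq take_size sq.
    apply: spec_weaken (leqnn _) _.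
      rewrite -{1}sp; apply: letter_body_spec; rewrite ?sp //.
        by rewrite all_rcons lq andbT; move: lwi; rewrite /letter; lia.
      by apply: table_eq tB; rewrite ?sp ?size_w //; lia.
    move=> rs' B' [pB' wB' tB' [N2 [cN2 [s2 [j2 [cJ2 [d2 [t12 [t22 [t32 ->]]]]]]]]]].
    split=> //.
      apply: (@table_eq _ (rcons q t.+1)); rewrite ?sp ?size_w //; try lia.
      by move=> x lx; apply: tB'; lia.
    exists t.+1, N2, cN2, s2, j2, cJ2, d2, t12, t22, t32; split=> //; first lia.
    rewrite sp big_nat_recr //= subn1 addnA; congr state.
    by rewrite enc_rcons addnS.
  + split=> //; exists 0, N, cN, sum, j, cJ, d, t1, t2, t3; split=> //.
    by rewrite big_geq // !addn0 /state !addn1.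
- move=> rs B [pB wB tB [t [N' [cN' [s' [j' [cJ' [d' [t1' [t2' [t3' [et tB' ->]]]]]]]]]]]].
  have {}et : t = wi by lia.
  have wi0 : 0 < wi by case/andP: lwi.
  rewrite et in tB' *; have {}tB' := tB' wi0.
  rewrite /state; isteps; iload (numU k (rcons q wi) n); first by rewrite addnC; apply: tB'; lia.
  isteps; apply: spec_skip; split=> //.
    apply: (@table_eq _ (rcons q wi)); rewrite ?size_rcons ?sq ?size_w //.
      by rewrite qE take_takel.
    by move=> x lx; apply: tB'; lia.
  (* The term of the letter [w_i] cancels against the subtracted table entry, and [X], one past the
     code of the prefix, is decreased. *)
  do 11 eexists; rewrite /state -qE enc_rcons -{1}(prednK wi0) big_nat_recr //= prednK //.
  by rewrite addnA addnK -addnBA // subn1.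
- move: lwi; rewrite /letter; nia.
Qed.

Lemma main_loop_spec wp acc V m I a X N cN sum j cJ d t1 t2 t3 A :
  wp = 32 * n + 1 -> powers_at A -> word_at A ->
  spec s main_loop (110 * (k * n ^ 3))
    (state wp acc V m I a X N cN sum j cJ d t1 t2 t3) A
    (fun rs A' => nth 0 rs 0 = rankU k w).
Proof.
move=> -> pw wd; rewrite /state /main_loop /block /=.
pose Inv c rs B := [/\ powers_at B, word_at B &
  exists i a X N cN sum j cJ d t1 t2 t3, [/\ i + c = n, table_at B w i.+1 &
  rs = state (32 * n + 1 + i)
    (1 + \sum_(0 <= i' < i) \sum_(0 <= t < (nth 0 w i').-1) numU k (rcons (take i' w) t.+1) n)
    (enc k (take i w)) i c a X N cN sum j cJ d t1 t2 t3]].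
eapply spec_time; first (isteps; eapply spec_seq).
- eapply (@spec_while _ _ _ (100 * (k * n ^ 2)) Inv n); [exact: s_ge | done | | |].
  + by move=> c rs B [_ _ [? [? [? [? [? [? [? [? [? [? [? [? [_ _ ->]]]]]]]]]]]]]].
  + move=> c rs B [pB wB [i [a' [X' [N' [cN' [s' [j' [cJ' [d' [t1' [t2' [t3' [ei tB ->]]]]]]]]]]]]]].
    apply: spec_weaken (leqnn _) _; first by apply: position_body_spec => //; lia.
    move=> rs' B' [pB' wB' tB' [a2 [X2 [N2 [cN2 [s2 [j2 [cJ2 [d2 [t12 [t22 [t32 ->]]]]]]]]]]]].
    split=> //; exists i.+1, a2, X2, N2, cN2, s2, j2, cJ2, d2, t12, t22, t32; split=> //; first lia.
    by rewrite big_nat_recr //= subn1 addnA (addnS (32 * n + 1)).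
  + split=> //; exists 0, a, X, N, cN, sum, j, cJ, d, t1, t2, t3; split=> //; first by move=> x; lia.
    by rewrite big_geq // take0 !addn0.
- move=> rs B [pB wB [i [a' [X' [N' [cN' [s' [j' [cJ' [d' [t1' [t2' [t3' [ei tB ->]]]]]]]]]]]]]].
  rewrite /state; isteps; apply: spec_skip; rewrite /= addn0 rankU_sum size_w.
  by have -> : i = n by lia.
- nia.
Qed.

(** The value [z] is arbitrary because register 21 may still hold a letter of [w]. *)
Lemma powers_spec wp acc V m I a X N cN sum j cJ d t1 t2 t3 z A :
  word_at A ->
  spec s powers (12 * n)
    [:: k; n; 1; 33 * n + 1; 34 * n + 2; wp; acc; V; m; I; a; X; N; cN; sum; j; cJ;
      d; t1; t2; t3; z] A
    (fun rs A' => [/\ powers_at A', word_at A' & exists I t1 t2,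
      rs = state wp acc V m I a X N cN sum j cJ d t1 t2 t3]).
Proof.
move=> wd; rewrite /powers /block /=.
pose Inv c rs B := [/\ forall x, x + c <= n -> B (34 * n + 2 + x) = k ^ x, word_at B & exists e,
  e + c = n /\
  rs = state wp acc V m c a X N cN sum j cJ d (k ^ e) (34 * n + 2 + e) t3].
eapply spec_time; first (isteps; eapply (spec_store s_ge);
  [done | cbn [nth]; rewrite /nreg /s; lia | cbn [nth]; isteps; eapply spec_seq]).
- eapply (@spec_while _ _ _ 4 Inv n); [exact: s_ge | done | | |].
  + by move=> c rs B [_ _ [e [_ ->]]].
  + move=> c rs B [pB wB [e [ee ->]]]; rewrite /state /power_body /block /=.
    isteps; eapply (spec_store s_ge); [done | cbn [nth] | cbn [nth]]; first by rewrite /nreg /s; lia.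
    isteps; apply: spec_skip; split.
    * move=> x lx; rewrite /upd; case: eqP => [e1|ne]; last by apply: pB; lia.
      by rewrite -expnSr; congr (_ ^ _); lia.
    * by move=> x le; rewrite /upd; case: eqP => [|_]; [lia | apply: wB].
    * by exists e.+1; split; [lia | rewrite -expnSr (addn1 (34 * n + 2 + e)) -addnS subn1].
  + split.
    * by move=> x lx; rewrite /upd; case: eqP; [|lia]; have -> : x = 0 by lia.
    * by move=> x le; rewrite /upd; case: eqP => [|_]; [lia | apply: wd].
    * by exists 0; split=> //; rewrite !addn0.
- move=> rs B [pB wB [e [ee ->]]]; apply: spec_skip; split=> //.
  + by move=> x lx; apply: pB; lia.
  + by do 3 eexists.
- nia.
Qed.

Lemma relocate_spec :
  spec s relocate (60 * n) (mkseq (ram_input k w) nreg) (ram_input k w)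
    (fun rs A => word_at A /\ exists r6 r7 r8 r9 r10 r11 r12 r13 r14 r15 r16 r17 r18 r19 r20 r21,
      rs = [:: k; n; 1; 33 * n + 1; 34 * n + 2; 32 * n + 1; r6; r7; r8; r9; r10; r11; r12;
               r13; r14; r15; r16; r17; r18; r19; r20; r21]).
Proof.
set R := ram_input k w.
have RE i : R (i.+2) = nth 0 w i by rewrite /R /ram_input /= subn2.
have R0 : R 0 = k by [].
have R1 : R 1 = n by rewrite /R /ram_input.
clearbody R.
pose rest := [seq R i | i <- iota 6 16].
have eM : mkseq R nreg = [:: k; n; nth 0 w 0; nth 0 w 1; nth 0 w 2; nth 0 w 3] ++ rest.
  by rewrite /mkseq /nreg /rest /= R0 R1 (RE 0) (RE 1) (RE 2) (RE 3).
have restE i : 6 <= i < nreg -> nth 0 rest (i - 6) = R i.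
  move=> li; rewrite (nth_map 0) ?size_iota; last by move: li; rewrite /nreg; lia.
  rewrite nth_iota; last by move: li; rewrite /nreg; lia.
  by rewrite subnKC //; case/andP: li.
have [r6 [r7 [r8 [r9 [r10 [r11 [r12 [r13 [r14 [r15 [r16 [r17 [r18 [r19 [r20 [r21 restL]]]]]]]]]]]]]]]] :
  exists r6 r7 r8 r9 r10 r11 r12 r13 r14 r15 r16 r17 r18 r19 r20 r21,
  rest = [:: r6; r7; r8; r9; r10; r11; r12; r13; r14; r15; r16; r17; r18; r19; r20; r21].
  by do 16 eexists.
(* After [t] rounds [4 + t] letters are copied. As [n - 4] is truncated, words of at most four
   letters need no round. Register 5 keeps [32 n], from which [n] is recovered by division. *)
pose Inv c rs B := [/\ B (32 * n) = k, forall a, nreg <= a < 32 * n -> B a = R a &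
  exists t x, [/\ c = n - 4 - t, t <= n - 4,
    forall i, i < n -> i < 4 + t -> B (32 * n + 1 + i) = nth 0 w i &
  rs = [:: 1; 32 * n + 4 + t; 5 + t; c; x; 32 * n] ++ rest]].
rewrite {}eM; clearbody rest; rewrite /relocate /block /=.
eapply spec_time.
- isteps.
  (* Register 1 is doubled five times, as no register is free for a constant; 32 is the first power
     of two above [nreg]. *)
  have -> : n + n + (n + n) + (n + n + (n + n)) + (n + n + (n + n) + (n + n + (n + n))) +
   (n + n + (n + n) + (n + n + (n + n)) + (n + n + (n + n) + (n + n + (n + n)))) = 32 * n by lia.
  do 5 (eapply (spec_store s_ge); [done | cbn [nth]; rewrite /nreg; lia | cbn [nth]]; isteps).
  have -> : 32 * n + 1 + 1 + 1 + 1 - 4 = 32 * n by lia.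
  rewrite mulKn //; eapply spec_seq.
  + eapply (@spec_while _ _ _ 5 Inv (n - 4)); [exact: s_ge | done | | |].
    * by move=> c rs B [_ _ [t [x [_ _ _ ->]]]].
    * move=> c rs B [Bk BR [t [x [ec lt Bw ->]]]]; rewrite /copy_body /block /=.
      isteps; eapply (@spec_load _ s_ge _ _ _ _ _ (R (5 + t + 1)));
        [done | cbn [nth]; lia | cbn [nth] | cbn [set_nth nth]].
        case: (ltnP (5 + t + 1) nreg) => l; last by rewrite memory_high //; apply: BR; lia.
        rewrite memory_low // -restE; last lia.
        have -> : 5 + t + 1 = 6 + t by lia.
        by rewrite (addKn 6 t).
      isteps; eapply (spec_store s_ge); [done | cbn [nth]; rewrite /nreg; lia | cbn [nth]].
      isteps; apply: spec_skip; split.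
      - by rewrite /upd; case: eqP; lia.
      - by move=> a la; rewrite /upd; case: eqP => [|_]; [lia | apply: BR].
      - exists t.+1, (R (5 + t + 1)); split; try lia.
          move=> i li li2; rewrite /upd; case: eqP => [e|ne]; last by apply: Bw => //; lia.
          by rewrite -RE; congr R; lia.
        by congr [:: _, _, _, _ & _]; lia.
    * split.
      - by rewrite /upd; do 4 (case: eqP => [|_]; first lia); rewrite eqxx.
      - move=> a la; rewrite /upd; do 5 (case: eqP => [|_]; first lia); done.
      - exists 0, 32; split; try lia.
          move=> i li li4; rewrite /upd.
          have : [|| i == 0, i == 1, i == 2 | i == 3] by lia.
          by case/or4P => /eqP ->; do ?(case: eqP => ? //; try lia).
        by congr [:: _, _, _, _ & _]; lia.
  + move=> rs B [Bk _ [t [x [ec lt Bw ->]]]].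
    rewrite /=; isteps; iload k; first exact: Bk.
    isteps; rewrite mulKn //; apply: spec_skip; split.
      by move=> i li; apply: Bw => //; lia.
    rewrite restL; do 16 eexists; congr [:: _, _, _, _, _, _ & _]; lia.
- nia.
Qed.

End Program.

(** * The complete program and its bounds *)

Definition rank_program : cmd := relocate ;; powers ;; main_loop.

Lemma rank_program_spec k n w : 0 < n -> 0 < k -> size w = n -> all (letter k) w ->
  spec (64 * n) rank_program (200 * (k * n ^ 3)) (mkseq (ram_input k w) nreg) (ram_input k w)
    (fun rs A => nth 0 rs 0 = rankU k w).
Proof.
move=> n0 k0 sw lw; eapply spec_time.
- eapply spec_seq; first by eapply relocate_spec.
  move=> rs A [wA [r6 [r7 [r8 [r9 [r10 [r11 [r12 [r13 [r14 [r15 [r16 [r17 [r18 [r19 [r20 [r21 ->]]]]]]]]]]]]]]]]].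
  eapply spec_seq; first by eapply (powers_spec n0 k0 sw lw).
  move=> rs' A' [pA' wA' [I [t1 [t2 ->]]]].
  by eapply main_loop_spec.
- have : n <= k * n ^ 3 by nia.
  lia.
Qed.

Theorem theorem10 :
  exists (p : seq instr) (C : nat),
    forall (n k : nat) (w : seq nat),
      1 <= n -> 2 <= k -> size w = n ->
      all (fun a => (1 <= a) && (a <= k)) w ->
      exists (t s : nat) (mf : nat -> nat),
        run (C * (k * n ^ 3)) p 0 (ram_input k w) = Some (t, s, mf) /\
        t <= C * (k * n ^ 3) /\ s <= C * n /\ mf 0 = rankU k w.
Proof.
(* One more than the factor 200 of [rank_program_spec] pays for the halting step, as [k * n ^ 3] is
   positive; 201 also covers the space bound [64 n]. *)
exists (compile 0 rank_program ++ [:: IHalt]), 201 => n k w n0 k2 sw lw.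
have pos : 0 < k * n ^ 3 by rewrite muln_gt0 expn_gt0 n0; lia.
have init : ram_input k w =1 memory (mkseq (ram_input k w) nreg) (ram_input k w).
  by move=> i; rewrite /memory; case: ltnP => // li; rewrite nth_mkseq.
have [||t [s [mf [rs [A [e lt ls em q]]]]]] :=
  spec_run (fuel := 201 * (k * n ^ 3)) (rank_program_spec n0 _ sw lw) init; try lia.
exists t, s, mf; split=> //; split; first lia; split; first lia.
by rewrite em memory_low.
Qed.
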